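(* Let $W_{\boldsymbol\lambda}\in \boldsymbol B(\ell^2)$ and $W_{\boldsymbol\omega}\in \boldsymbol B(\ell^2)$ be unilateral weighted shifts. Then the following conditions are equivalent: (i) there exists $X \in \boldsymbol B(\ell^2)$ whose range is dense in $\ell^2$ and such that $XW_{\boldsymbol\lambda} = W_{\boldsymbol\omega}X$, (ii) $W_{\boldsymbol\lambda}$ is a quasi-affine transform of $W_{\boldsymbol\omega}$, (iii) $\sup_{n\in \mathbb Z_+} \frac{\hat\omega_n}{\hat\lambda_n} < \infty$.
   Context: $\mathbb Z_+=\{0,1,2,\dots\}$; $\{e_n\}_{n=0}^\infty$ is the standard orthonormal basis of the complex Hilbert space $\ell^2=\ell^2(\mathbb Z_+)$; $\boldsymbol B(\ell^2)$ is the set of bounded linear operators on $\ell^2$. For a bounded sequence $\boldsymbol\lambda=\{\lambda_n\}_{n=0}^\infty\subseteq(0,\infty)$, the unilateral weighted shift $W_{\boldsymbol\lambda}\in\boldsymbol B(\ell^2)$ is the operator with $W_{\boldsymbol\lambda}e_n=\lambda_n e_{n+1}$, $n\in\mathbb Z_+$. Put $\hat\lambda_0=1$ and $\hat\lambda_n=\lambda_0^2\cdots\lambda_{n-1}^2$ for $n\geqslant1$; $\hat\omega_n$ is defined analogously from $\boldsymbol\omega=\{\omega_n\}_{n=0}^\infty$. An operator is quasi-invertible if it is injective and has dense range; $A\in\boldsymbol B(\mathcal H)$ is a quasi-affine transform of $B\in\boldsymbol B(\mathcal K)$ if there is a quasi-invertible bounded linear $X\colon\mathcal H\to\mathcal K$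 with $XA=BX$. *)

(* Defs.v *)
From Stdlib Require Import Reals Lra Lia FunctionalExtensionality ProofIrrelevance.
From Coquelicot Require Import Coquelicot.
Open Scope R_scope.

Definition sq_summable (x : nat -> C) : Prop :=
  ex_series (fun n => Cmod (x n) ^ 2).

Definition ell2 : Type := {x : nat -> C | sq_summable x}.

Definition coord (x : ell2) (n : nat) : C := proj1_sig x n.

Lemma ell2_ext (x y : ell2) : (forall n, coord x n = coord y n) -> x = y.
Proof.
destruct x as [x Hx], y as [y Hy]; unfold coord; simpl; intros H.
assert (E : x = y) by (now apply functional_extensionality).
subst y; now rewrite (proof_irrelevance _ Hx Hy).
Qed.

Lemma Cmod_plus_sq (a b : C) (s t : R) : 0 < s -> 0 < t ->
  Cmod (a + b) ^ 2 <= (s + t) / s * Cmod a ^ 2 + (s + t) / t * Cmod b ^ 2.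
Proof.
intros Hs Ht.
apply Rle_trans with ((Cmod a + Cmod b) ^ 2).
{ apply pow_incr; split; [apply Cmod_ge_0 | apply Cmod_triangle]. }
generalize (Cmod a) (Cmod b); intros u v.
assert (H : (s + t) / s * u ^ 2 + (s + t) / t * v ^ 2 - (u + v) ^ 2
            = (t * u - s * v) ^ 2 / (s * t)) by (field; lra).
assert (0 <= (t * u - s * v) ^ 2 / (s * t)).
{ apply Rmult_le_pos; [apply pow2_ge_0|].
  apply Rlt_le, Rinv_0_lt_compat, Rmult_lt_0_compat; lra. }
lra.
Qed.

Lemma ex_series_le_pos (a b : nat -> R) :
  (forall n, 0 <= a n <= b n) -> ex_series b -> ex_series a.
Proof.
intros H; apply (@ex_series_le R_AbsRing R_CompleteNormedModule); intros n.
change (Rabs (a n) <= b n); rewrite Rabs_pos_eq; apply H.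
Qed.

Lemma sq_summable_comb (c d : R) (x y : nat -> C) :
  sq_summable x -> sq_summable y ->
  ex_series (fun n => c * Cmod (x n) ^ 2 + d * Cmod (y n) ^ 2).
Proof.
intros Hx Hy.
apply (@ex_series_plus R_AbsRing R_NormedModule
        (fun n => c * Cmod (x n) ^ 2) (fun n => d * Cmod (y n) ^ 2));
  now apply (@ex_series_scal_l R_AbsRing).
Qed.

Lemma sq_summable_plus (x y : nat -> C) :
  sq_summable x -> sq_summable y -> sq_summable (fun n => x n + y n)%C.
Proof.
intros Hx Hy.
apply ex_series_le_pos with (2 := sq_summable_comb ((1 + 1) / 1) ((1 + 1) / 1) x y Hx Hy).
intros n; split; [apply pow2_ge_0 | apply Cmod_plus_sq; lra].
Qed.

Lemma sq_summable_scal (k : C) (x : nat -> C) :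
  sq_summable x -> sq_summable (fun n => k * x n)%C.
Proof.
intros Hx.
apply ex_series_ext with (fun n => Cmod k ^ 2 * Cmod (x n) ^ 2).
{ intros n; simpl; rewrite Cmod_mult; ring. }
now apply (@ex_series_scal_l R_AbsRing).
Qed.

Lemma sq_summable_opp (x : nat -> C) :
  sq_summable x -> sq_summable (fun n => - x n)%C.
Proof.
intros Hx; apply ex_series_ext with (2 := Hx).
intros n; now rewrite Cmod_opp.
Qed.

Lemma sq_summable_fin (x : nat -> C) (N : nat) :
  (forall n, (N <= n)%nat -> x n = 0%C) -> sq_summable x.
Proof.
intros H; unfold sq_summable; rewrite (ex_series_incr_n _ N).
apply ex_series_ext with (fun n => 0 * (/ 2) ^ n).
{ intros n; rewrite H by lia; rewrite Cmod_0; simpl; ring. }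
apply (@ex_series_scal_l R_AbsRing), ex_series_geom.
rewrite Rabs_pos_eq; lra.
Qed.

Definition ell2_zero : ell2 :=
  exist sq_summable (fun _ => RtoC 0)
    (sq_summable_fin (fun _ => RtoC 0) 0 (fun _ _ => eq_refl)).

Definition ell2_plus (x y : ell2) : ell2 :=
  exist _ _ (sq_summable_plus _ _ (proj2_sig x) (proj2_sig y)).

Definition ell2_opp (x : ell2) : ell2 :=
  exist _ _ (sq_summable_opp _ (proj2_sig x)).

Definition ell2_scal (k : C) (x : ell2) : ell2 :=
  exist _ _ (sq_summable_scal k _ (proj2_sig x)).

Definition ell2_norm (x : ell2) : R :=
  sqrt (Series (fun n => Cmod (coord x n) ^ 2)).

Lemma ell2_plus_comm x y : ell2_plus x y = ell2_plus y x.
Proof. apply ell2_ext; intros n; apply Cplus_comm. Qed.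

Lemma ell2_plus_assoc x y z :
  ell2_plus x (ell2_plus y z) = ell2_plus (ell2_plus x y) z.
Proof. apply ell2_ext; intros n; apply Cplus_assoc. Qed.

Lemma ell2_plus_zero x : ell2_plus x ell2_zero = x.
Proof. apply ell2_ext; intros n; apply Cplus_0_r. Qed.

Lemma ell2_plus_opp x : ell2_plus x (ell2_opp x) = ell2_zero.
Proof. apply ell2_ext; intros n; apply Cplus_opp_r. Qed.

Definition ell2_AbelianMonoid_mixin :=
  AbelianMonoid.Mixin ell2 ell2_plus ell2_zero
    ell2_plus_comm ell2_plus_assoc ell2_plus_zero.

Canonical ell2_AbelianMonoid :=
  AbelianMonoid.Pack ell2 ell2_AbelianMonoid_mixin ell2.

Definition ell2_AbelianGroup_mixin :=
  AbelianGroup.Mixin ell2_AbelianMonoid ell2_opp ell2_plus_opp.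

Canonical ell2_AbelianGroup :=
  AbelianGroup.Pack ell2
    (AbelianGroup.Class _ ell2_AbelianMonoid_mixin ell2_AbelianGroup_mixin) ell2.

Lemma ell2_scal_assoc (a b : C) x :
  ell2_scal a (ell2_scal b x) = ell2_scal (a * b)%C x.
Proof. apply ell2_ext; intros n; apply Cmult_assoc. Qed.

Lemma ell2_scal_one x : ell2_scal 1%C x = x.
Proof. apply ell2_ext; intros n; apply Cmult_1_l. Qed.

Lemma ell2_scal_plus_r (a : C) x y :
  ell2_scal a (ell2_plus x y) = ell2_plus (ell2_scal a x) (ell2_scal a y).
Proof. apply ell2_ext; intros n; apply Cmult_plus_distr_l. Qed.

Lemma ell2_scal_plus_l (a b : C) x :
  ell2_scal (a + b)%C x = ell2_plus (ell2_scal a x) (ell2_scal b x).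
Proof. apply ell2_ext; intros n; apply Cmult_plus_distr_r. Qed.

Definition ell2_ModuleSpace_mixin : ModuleSpace.mixin_of C_Ring ell2_AbelianGroup :=
  ModuleSpace.Mixin C_Ring ell2_AbelianGroup ell2_scal
    ell2_scal_assoc ell2_scal_one ell2_scal_plus_r ell2_scal_plus_l.

Canonical ell2_ModuleSpace :=
  ModuleSpace.Pack C_Ring ell2
    (ModuleSpace.Class C_Ring _ _ ell2_ModuleSpace_mixin) ell2.

Lemma ell2_norm_sq_pos (x : ell2) : 0 <= Series (fun n => Cmod (coord x n) ^ 2).
Proof.
replace 0 with (Series (fun n => 0 * Cmod (coord x n) ^ 2)).
2: { rewrite Series_scal_l; ring. }
apply Series_le; [| exact (proj2_sig x)].
intros n; generalize (pow2_ge_0 (Cmod (coord x n))); lra.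
Qed.

Lemma ell2_norm_ge_0 x : 0 <= ell2_norm x.
Proof. apply sqrt_pos. Qed.

Lemma ell2_norm_sq x : ell2_norm x ^ 2 = Series (fun n => Cmod (coord x n) ^ 2).
Proof. apply pow2_sqrt, ell2_norm_sq_pos. Qed.

Lemma ell2_norm_triangle x y :
  ell2_norm (ell2_plus x y) <= ell2_norm x + ell2_norm y.
Proof.
apply le_epsilon; intros e He.
set (s := ell2_norm x + e / 2); set (t := ell2_norm y + e / 2).
assert (Hx := ell2_norm_ge_0 x); assert (Hy := ell2_norm_ge_0 y).
assert (Hs : 0 < s) by (unfold s; lra).
assert (Ht : 0 < t) by (unfold t; lra).
replace (ell2_norm x + ell2_norm y + e) with (s + t) by (unfold s, t; field).
apply Rsqr_incr_0_var; [|lra].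
rewrite !Rsqr_pow2, ell2_norm_sq.
apply Rle_trans with ((s + t) / s * ell2_norm x ^ 2 + (s + t) / t * ell2_norm y ^ 2).
- rewrite !ell2_norm_sq, <- !Series_scal_l, <- Series_plus.
  + apply Series_le.
    * intros n; split; [apply pow2_ge_0 | now apply Cmod_plus_sq].
    * apply sq_summable_comb; [exact (proj2_sig x) | exact (proj2_sig y)].
  + apply (@ex_series_scal_l R_AbsRing), (proj2_sig x).
  + apply (@ex_series_scal_l R_AbsRing), (proj2_sig y).
- assert (H1 : ell2_norm x ^ 2 <= s ^ 2) by (apply pow_incr; unfold s; lra).
  assert (H2 : ell2_norm y ^ 2 <= t ^ 2) by (apply pow_incr; unfold t; lra).
  replace ((s + t) ^ 2) with ((s + t) / s * s ^ 2 + (s + t) / t * t ^ 2)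
    by (field; lra).
  apply Rplus_le_compat; apply Rmult_le_compat_l; trivial;
    apply Rlt_le, Rdiv_lt_0_compat; lra.
Qed.

Lemma ell2_norm_scal (k : C) x : ell2_norm (ell2_scal k x) = Cmod k * ell2_norm x.
Proof.
unfold ell2_norm.
rewrite <- (sqrt_pow2 (Cmod k)) by apply Cmod_ge_0.
rewrite <- sqrt_mult by (apply pow2_ge_0 || apply ell2_norm_sq_pos).
rewrite <- Series_scal_l; f_equal; apply Series_ext; intros n.
change (coord (ell2_scal k x) n) with (k * coord x n)%C.
rewrite Cmod_mult; ring.
Qed.

Lemma ell2_norm_eq_0 x : ell2_norm x = 0 -> x = ell2_zero.
Proof.
intros H; apply ell2_ext; intros n; apply Cmod_eq_0.
assert (H2 : Series (fun n => Cmod (coord x n) ^ 2) = 0).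
{ rewrite <- ell2_norm_sq, H; ring. }
assert (Hle : Cmod (coord x n) ^ 2 <= 0).
{ rewrite <- H2.
  rewrite (Series_incr_n _ (S n)); [| lia | exact (proj2_sig x)]; simpl pred.
  assert (Hr : 0 <= Series (fun k => Cmod (coord x (S n + k)) ^ 2)).
  { replace 0 with (Series (fun k => 0 * Cmod (coord x (S n + k)) ^ 2)).
    2: { rewrite Series_scal_l; ring. }
    apply Series_le.
    - intros k; generalize (pow2_ge_0 (Cmod (coord x (S n + k)))); lra.
    - apply (ex_series_incr_n (fun k => Cmod (coord x k) ^ 2)), (proj2_sig x). }
  assert (Hs : Cmod (coord x n) ^ 2 <= sum_f_R0 (fun k => Cmod (coord x k) ^ 2) n).
  { destruct n as [|n]; [apply Rle_refl | rewrite tech5].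
    assert (0 <= sum_f_R0 (fun k => Cmod (coord x k) ^ 2) n)
      by (apply cond_pos_sum; intros k; apply pow2_ge_0).
    lra. }
  lra. }
assert (Hp := Cmod_ge_0 (coord x n)); nra.
Qed.

Definition ell2_ball (x : ell2) (eps : R) (y : ell2) : Prop :=
  ell2_norm (minus y x) < eps.

Lemma ell2_ball_center x (e : posreal) : ell2_ball x e x.
Proof.
unfold ell2_ball.
replace (minus x x) with (ell2_scal 0%C x).
2: { apply ell2_ext; intros n.
     change (0 * coord x n = coord x n + - coord x n)%C; ring. }
rewrite ell2_norm_scal, Cmod_0, Rmult_0_l; apply cond_pos.
Qed.

Lemma ell2_ball_sym x y e : ell2_ball x e y -> ell2_ball y e x.
Proof.
unfold ell2_ball.
replace (minus x y) with (ell2_scal (- (1))%C (minus y x)).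
{ now rewrite ell2_norm_scal, Cmod_m1, Rmult_1_l. }
apply ell2_ext; intros n.
change (- (1) * (coord y n + - coord x n) = coord x n + - coord y n)%C; ring.
Qed.

Lemma ell2_ball_triangle x y z e1 e2 :
  ell2_ball x e1 y -> ell2_ball y e2 z -> ell2_ball x (e1 + e2) z.
Proof.
unfold ell2_ball; intros H1 H2.
replace (minus z x) with (ell2_plus (minus y x) (minus z y)).
{ eapply Rle_lt_trans; [apply ell2_norm_triangle | lra]. }
apply ell2_ext; intros n.
change ((coord y n + - coord x n) + (coord z n + - coord y n)
        = coord z n + - coord x n)%C; ring.
Qed.

Definition ell2_UniformSpace_mixin :=
  UniformSpace.Mixin ell2 ell2_zero ell2_ball
    ell2_ball_center ell2_ball_sym ell2_ball_triangle.

Canonical ell2_UniformSpace :=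
  UniformSpace.Pack ell2 ell2_UniformSpace_mixin ell2.

Canonical ell2_NormedModuleAux :=
  NormedModuleAux.Pack C_AbsRing ell2
    (NormedModuleAux.Class C_AbsRing _
      (ModuleSpace.class C_Ring ell2_ModuleSpace)
      (UniformSpace.class ell2_UniformSpace)) ell2.

Lemma ell2_norm_scal_le (k : C) x :
  ell2_norm (ell2_scal k x) <= Cmod k * ell2_norm x.
Proof. rewrite ell2_norm_scal; apply Rle_refl. Qed.

Lemma ell2_norm_compat1 (x y : ell2) (eps : R) :
  ell2_norm (minus y x) < eps -> ell2_ball x eps y.
Proof. trivial. Qed.

Lemma ell2_norm_compat2 (x y : ell2) (eps : posreal) :
  ell2_ball x eps y -> ell2_norm (minus y x) < 1 * eps.
Proof. now rewrite Rmult_1_l. Qed.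

Definition ell2_NormedModule_mixin :
    NormedModule.mixin_of C_AbsRing ell2_NormedModuleAux :=
  NormedModule.Mixin C_AbsRing ell2_NormedModuleAux ell2_norm 1
    ell2_norm_triangle ell2_norm_scal_le
    ell2_norm_compat1 ell2_norm_compat2 ell2_norm_eq_0.

Canonical ell2_NormedModule :=
  NormedModule.Pack C_AbsRing ell2
    (NormedModule.Class C_AbsRing _
      (NormedModuleAux.class C_AbsRing ell2_NormedModuleAux)
      ell2_NormedModule_mixin) ell2.

Lemma delta_sq_summable (n : nat) :
  sq_summable (fun k => if Nat.eqb k n then 1%C else 0%C).
Proof.
apply sq_summable_fin with (S n); intros k Hk.
now rewrite (proj2 (Nat.eqb_neq k n)) by lia.
Qed.

Definition basis (n : nat) : ell2 := exist _ _ (delta_sq_summable n).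

Definition has_dense_range {K : AbsRing} {U V : NormedModule K} (X : U -> V) : Prop :=
  forall (y : V) (eps : posreal), exists x : U, ball y eps (X x).

Definition quasi_invertible {K : AbsRing} {U V : NormedModule K} (X : U -> V) : Prop :=
  (forall x y : U, X x = X y -> x = y) /\ has_dense_range X.

(** Coquelicot's [is_linear] includes boundedness, so it is
    membership in the space of bounded linear operators. *)
Definition quasi_affine_transform {K : AbsRing} {U V : NormedModule K}
    (A : U -> U) (B : V -> V) : Prop :=
  exists X : U -> V,
    is_linear X /\ quasi_invertible X /\ (forall x : U, X (A x) = B (X x)).

Definition bounded_positive (lam : nat -> R) : Prop :=
  (forall n, 0 < lam n) /\ (exists M : R, forall n, lam n <= M).

(** A bounded operator is determined by its values on the basis, so this
    characterizes [W] uniquely; existence is [weighted_shift_exists]. *)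
Definition is_weighted_shift (lam : nat -> R) (W : ell2 -> ell2) : Prop :=
  bounded_positive lam /\ is_linear W /\
  (forall n, W (basis n) = scal (RtoC (lam n)) (basis (S n))).

Fixpoint hat (lam : nat -> R) (n : nat) : R :=
  match n with
  | O => 1
  | S m => hat lam m * lam m ^ 2
  end.

Definition shift_seq (lam : nat -> R) (x : nat -> C) (n : nat) : C :=
  match n with
  | O => 0%C
  | S m => (RtoC (lam m) * x m)%C
  end.

Lemma Cmod_shift_le (lam : nat -> R) (M : R) (x : nat -> C) (n : nat) :
  (forall n, 0 < lam n) -> (forall n, lam n <= M) ->
  0 <= Cmod (shift_seq lam x (S n)) ^ 2 <= M ^ 2 * Cmod (x n) ^ 2.
Proof.
intros H0 HM; split; [apply pow2_ge_0|]; simpl shift_seq.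
rewrite Cmod_mult, Cmod_R, Rabs_pos_eq, Rpow_mult_distr by apply Rlt_le, H0.
apply Rmult_le_compat_r; [apply pow2_ge_0|].
apply pow_incr; split; [apply Rlt_le, H0 | apply HM].
Qed.

Lemma shift_sq_summable (lam : nat -> R) (x : nat -> C) :
  bounded_positive lam -> sq_summable x -> sq_summable (shift_seq lam x).
Proof.
intros [H0 [M HM]] Hx; unfold sq_summable; apply ex_series_incr_1.
apply ex_series_le_pos with (fun n => M ^ 2 * Cmod (x n) ^ 2).
- intros n; now apply Cmod_shift_le.
- now apply (@ex_series_scal_l R_AbsRing).
Qed.

Lemma weighted_shift_exists (lam : nat -> R) :
  bounded_positive lam -> exists W, is_weighted_shift lam W.
Proof.
intros Hl.
exists (fun x => exist _ _ (shift_sq_summable lam _ Hl (proj2_sig x))).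
split; [exact Hl | split; [split |]].
- intros x y; apply ell2_ext; intros [|n].
  + symmetry; apply Cplus_0_r.
  + apply Cmult_plus_distr_l.
- intros k x; apply ell2_ext; intros [|n].
  + symmetry; apply Cmult_0_r.
  + change (RtoC (lam n) * (k * coord x n) = k * (RtoC (lam n) * coord x n))%C; ring.
- destruct (Hl) as [H0 [M HM]].
  assert (HM0 : 0 < M) by (apply Rlt_le_trans with (2 := HM O), H0).
  exists M; split; [exact HM0|]; intros x.
  apply Rsqr_incr_0_var.
  2: { apply Rmult_le_pos; [lra | apply ell2_norm_ge_0]. }
  rewrite !Rsqr_pow2, Rpow_mult_distr.
  change (ell2_norm (exist _ _ (shift_sq_summable lam _ Hl (proj2_sig x))) ^ 2
          <= M ^ 2 * ell2_norm x ^ 2).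
  rewrite !ell2_norm_sq, <- Series_scal_l.
  rewrite Series_incr_1 by (apply shift_sq_summable; [exact Hl | exact (proj2_sig x)]).
  unfold coord; simpl proj1_sig; simpl (shift_seq _ _ 0).
  rewrite Cmod_0, pow_i, Rplus_0_l by lia.
  apply Series_le.
  + intros n; now apply Cmod_shift_le.
  + apply (@ex_series_scal_l R_AbsRing), (proj2_sig x).
- intros n; apply ell2_ext; intros [|k]; unfold coord; simpl.
  + symmetry; apply Cmult_0_r.
  + change (RtoC (lam k) * (if Nat.eqb k n then 1 else 0)
            = RtoC (lam n) * (if Nat.eqb k n then 1 else 0))%C.
    destruct (Nat.eqb_spec k n) as [->|]; [reflexivity | now rewrite !Cmult_0_r].
Qed.

(* Main.v *)
Require Import Defs.
From Stdlib Require Import Reals Lra Lia.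
From Coquelicot Require Import Coquelicot.
Open Scope R_scope.

(** Let [X] intertwine the shifts.  Applying it to the basis gives
    [lam n * X e_(n+1) = Wom (X e_n)], so the diagonal entries
    [(X e_n)_n] of [X] obey the recursion of
    [d_n = sqrt (hat om n / hat lam n)], that is [(X e_n)_n = d_n (X e_0)_0].
    Moreover [(X e_n)_0 = 0] for [n > 0], because the range of a shift is
    orthogonal to [e_0].  If [(X e_0)_0] vanished as well, the bounded
    functional [x |-> (X x)_0] would be zero on the basis, hence everywhere
    ([is_linear_ext_basis]), and no [X x] could approach [e_0].  So density
    of the range forces [(X e_0)_0 <> 0], and boundedness of [X] on the unit
    vectors [e_n] bounds [d_n] ([dense_intertwiner_ratio_bounded]).

    Conversely, if [d] is bounded, the diagonal operator with entries [d_n]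
    is bounded; it is injective with dense range because no [d_n] vanishes,
    and it intertwines the shifts by the recursion for [d]
    ([bounded_ratio_quasi_affine]).  A quasi-affine transform provides in
    particular an intertwiner with dense range, which closes the circle. *)

(** * Norm estimates and finitely supported vectors *)

Lemma ell2_norm_le (M : R) (x y : ell2) : 0 <= M ->
  (forall n, Cmod (coord x n) <= M * Cmod (coord y n)) ->
  ell2_norm x <= M * ell2_norm y.
Proof.
intros HM H.
apply Rsqr_incr_0_var.
2: { apply Rmult_le_pos; [exact HM | apply ell2_norm_ge_0]. }
rewrite !Rsqr_pow2, Rpow_mult_distr, !ell2_norm_sq, <- Series_scal_l.
apply Series_le.
- intros n; split; [apply pow2_ge_0|].
  rewrite <- Rpow_mult_distr; apply pow_incr; split; [apply Cmod_ge_0 | apply H].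
- apply (@ex_series_scal_l R_AbsRing), (proj2_sig y).
Qed.

Lemma sq_summable_truncate (N : nat) (a : nat -> C) :
  sq_summable (fun k => if Nat.ltb k N then a k else 0%C).
Proof.
apply sq_summable_fin with N; intros k Hk.
now rewrite (proj2 (Nat.ltb_ge k N)).
Qed.

(** [a] is a bare sequence because preimages under a diagonal operator with
    unbounded inverse are truncations of sequences outside [ell2]. *)
Definition truncate (N : nat) (a : nat -> C) : ell2 :=
  exist _ _ (sq_summable_truncate N a).

Lemma coord_truncate (N : nat) (a : nat -> C) (k : nat) :
  coord (truncate N a) k = if Nat.ltb k N then a k else 0%C.
Proof. reflexivity. Qed.

Lemma truncate_S (N : nat) (a : nat -> C) :
  truncate (S N) a = plus (truncate N a) (scal (a N) (basis N)).
Proof.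
apply ell2_ext; intros k.
change ((if Nat.ltb k (S N) then a k else 0)
  = (if Nat.ltb k N then a k else 0) + a N * (if Nat.eqb k N then 1 else 0))%C.
destruct (Nat.ltb_spec k (S N)), (Nat.ltb_spec k N), (Nat.eqb_spec k N);
  subst; try lia; ring.
Qed.

Lemma norm_truncate_sq (N : nat) (a : nat -> C) :
  ell2_norm (truncate (S N) a) ^ 2 = sum_f_R0 (fun k => Cmod (a k) ^ 2) N.
Proof.
rewrite ell2_norm_sq, (Series_incr_n _ (S N));
  [| lia | exact (proj2_sig (truncate (S N) a))].
rewrite (Series_ext _ (fun k => 0 * 0)), Series_scal_l, Rmult_0_l, Rplus_0_r.
- apply sum_eq; intros k Hk; rewrite coord_truncate.
  now rewrite (proj2 (Nat.ltb_lt k (S N))) by lia.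
- intros k; rewrite coord_truncate.
  rewrite (proj2 (Nat.ltb_ge (S N + k) (S N))), Cmod_0 by lia; ring.
Qed.

Lemma ell2_norm_basis (n : nat) : ell2_norm (basis n) = 1.
Proof.
assert (E : basis n = truncate (S n) (coord (basis n))).
{ apply ell2_ext; intros k; unfold coord; simpl.
  destruct (Nat.ltb_spec k (S n)), (Nat.eqb_spec k n); trivial; lia. }
assert (H : ell2_norm (basis n) ^ 2 = 1).
{ rewrite E, norm_truncate_sq.
  assert (Hn : Cmod (coord (basis n) n) ^ 2 = 1)
    by (unfold coord; simpl; rewrite Nat.eqb_refl, Cmod_1; ring).
  assert (H0 : forall k, (k < n)%nat -> Cmod (coord (basis n) k) ^ 2 = 0).
  { intros k Hk; unfold coord; simpl proj1_sig.
    rewrite (proj2 (Nat.eqb_neq k n)), Cmod_0 by lia; ring. }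
  destruct n as [|n]; [exact Hn | rewrite tech5, Hn].
  rewrite (sum_eq _ (fun _ => 0)) by (intros; apply H0; lia).
  rewrite sum_cte; ring. }
assert (Hp := ell2_norm_ge_0 (basis n)); nra.
Qed.

Lemma Cmod_coord_le (x : ell2) (n : nat) : Cmod (coord x n) <= ell2_norm x.
Proof.
replace (Cmod (coord x n)) with (ell2_norm (scal (coord x n) (basis n))).
(* [scal (coord x n) (basis n)] is dominated by [x] in every coordinate. *)
- rewrite <- (Rmult_1_l (ell2_norm x)); apply ell2_norm_le; [lra|]; intros k.
  change (Cmod (coord x n * (if Nat.eqb k n then 1 else 0))
    <= 1 * Cmod (coord x k)).
  rewrite Rmult_1_l; destruct (Nat.eqb_spec k n) as [->|].
  + rewrite Cmult_1_r; apply Rle_refl.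
  + rewrite Cmult_0_r, Cmod_0; apply Cmod_ge_0.
- change (ell2_norm (ell2_scal (coord x n) (basis n)) = Cmod (coord x n)).
  rewrite ell2_norm_scal, ell2_norm_basis; ring.
Qed.

Lemma truncate_dense (x : ell2) (eps : R) : 0 < eps ->
  exists N, ell2_norm (minus x (truncate N (coord x))) < eps.
Proof.
intros He.
pose (a := fun k => Cmod (coord x k) ^ 2).
assert (Ha : ex_series a) by exact (proj2_sig x).
assert (HL := Series_correct a Ha).
assert (He2 : 0 < eps ^ 2) by (apply pow_lt; exact He).
(* Beyond [N] the squared norm of the tail is below [eps ^ 2]. *)
destruct (HL _ (locally_ball (Series a) (mkposreal _ He2))) as [N HN].
specialize (HN N (Nat.le_refl N)).
change (Rabs (sum_n a N - Series a) < eps ^ 2) in HN.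
exists (S N).
set (t := minus x (truncate (S N) (coord x))).
assert (Ht : forall k, coord t k = if Nat.ltb k (S N) then 0%C else coord x k).
{ intros k.
  change (coord t k)
    with (coord x k - (if Nat.ltb k (S N) then coord x k else 0))%C.
  destruct (Nat.ltb k (S N)); ring. }
assert (E : ell2_norm t ^ 2 = Series a - sum_n a N).
{ rewrite ell2_norm_sq, (Series_incr_n _ (S N)); [| lia | exact (proj2_sig t)].
  rewrite (Series_incr_n a (S N)); [| lia | exact Ha].
  simpl pred; rewrite sum_n_Reals.
  rewrite (sum_eq _ (fun _ => 0)), sum_cte.
  - rewrite (Series_ext _ (fun k => a (S N + k)%nat)); [ring|].
    intros k; rewrite Ht, (proj2 (Nat.ltb_ge (S N + k) (S N))) by lia.
    reflexivity.
  - intros k Hk; rewrite Ht, (proj2 (Nat.ltb_lt k (S N))), Cmod_0 by lia.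
    ring. }
apply Rabs_def2 in HN.
apply Rnot_le_lt; intros Hc.
assert (eps ^ 2 <= ell2_norm t ^ 2) by (apply pow_incr; lra); lra.
Qed.

(** * Bounded operators are determined by the basis *)

Lemma minus_minus_cancel {G : AbelianGroup} (a b c : G) :
  minus (minus a c) (minus b c) = minus a b.
Proof.
now rewrite (minus_trans c a b), <- (opp_minus b c).
Qed.

Lemma is_linear_minus {V : NormedModule C_AbsRing} (f : ell2 -> V) (x y : ell2) :
  is_linear f -> f (minus x y) = minus (f x) (f y).
Proof.
intros Hf; unfold minus.
rewrite (linear_plus f Hf); f_equal.
transitivity (f (scal (opp one : C_AbsRing) y)).
- f_equal; symmetry; apply (scal_opp_one (V := ell2_ModuleSpace)).
- rewrite (linear_scal f Hf); apply (scal_opp_one (V := NormedModule.ModuleSpace _ V)).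
Qed.

(** Two such maps agree on truncations by linearity, and truncations
    approximate every vector. *)
Lemma is_linear_ext_basis {V : NormedModule C_AbsRing} (f g : ell2 -> V) :
  is_linear f -> is_linear g ->
  (forall n, f (basis n) = g (basis n)) -> forall x, f x = g x.
Proof.
intros Hf Hg H x.
assert (Hfin : forall N a, f (truncate N a) = g (truncate N a)).
{ intros N a; induction N as [|N IH].
  - replace (truncate 0 a) with (@zero (NormedModule.AbelianMonoid _ ell2_NormedModule)) by (now apply ell2_ext).
    now rewrite (linear_zero f Hf), (linear_zero g Hg).
  - rewrite truncate_S, (linear_plus f Hf), (linear_plus g Hg).
    now rewrite (linear_scal f Hf), (linear_scal g Hg), IH, H. }
destruct (linear_norm f Hf) as [Mf [HMf Bf]].
destruct (linear_norm g Hg) as [Mg [HMg Bg]].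
assert (E : norm (minus (f x) (g x)) <= 0).
{ apply le_epsilon; intros e He.
  assert (He' : 0 < e / (Mf + Mg)) by (apply Rdiv_lt_0_compat; lra).
  destruct (truncate_dense x _ He') as [N HN].
  set (t := minus x (truncate N (coord x))) in HN.
  assert (Et : minus (f x) (g x) = minus (f t) (g t)).
  { unfold t; rewrite !is_linear_minus by assumption; rewrite Hfin.
    symmetry; apply minus_minus_cancel. }
  rewrite Et; unfold minus at 1.
  apply Rle_trans with (norm (f t) + norm (g t)).
  { rewrite <- (norm_opp (g t)); apply norm_triangle. }
  specialize (Bf t); specialize (Bg t).
  change (norm t) with (ell2_norm t) in Bf, Bg.
  assert ((Mf + Mg) * ell2_norm t <= (Mf + Mg) * (e / (Mf + Mg)))
    by (apply Rmult_le_compat_l; lra).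
  replace ((Mf + Mg) * (e / (Mf + Mg))) with e in * by (field; lra).
  lra. }
assert (E0 : minus (f x) (g x) = zero).
{ apply norm_eq_zero, Rle_antisym; [exact E | apply norm_ge_0]. }
apply plus_reg_r with (opp (g x)).
now rewrite plus_opp_r.
Qed.

Lemma is_linear_coord_scal (k : C) (n : nat) :
  is_linear (V := C_NormedModule) (fun x : ell2 => (k * coord x n)%C).
Proof.
split.
- intros x y; apply Cmult_plus_distr_l.
- intros c x.
  change (k * (c * coord x n) = c * (k * coord x n))%C; ring.
- assert (Hk := Cmod_ge_0 k).
  exists (Cmod k + 1); split; [lra|]; intros x.
  change (Cmod (k * coord x n) <= (Cmod k + 1) * ell2_norm x).
  rewrite Cmod_mult.
  assert (H := Cmod_coord_le x n); assert (H0 := Cmod_ge_0 (coord x n)); nra.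
Qed.

Lemma is_linear_coord (X : ell2 -> ell2) (n : nat) :
  is_linear X -> is_linear (V := C_NormedModule) (fun x => coord (X x) n).
Proof.
intros HX.
apply (is_linear_comp X (V := ell2_NormedModule) (W := C_NormedModule)
  (fun x : ell2 => coord x n) HX).
split; [reflexivity | reflexivity |].
exists 1; split; [lra|]; intros x; rewrite Rmult_1_l; apply Cmod_coord_le.
Qed.

(** The defining property fixes [W] on the basis only; both sides are bounded
    functionals of [x], so the basis decides. *)
Lemma coord_weighted_shift (lam : nat -> R) (W : ell2 -> ell2) :
  is_weighted_shift lam W ->
  forall x n, coord (W x) n = shift_seq lam (coord x) n.
Proof.
intros [_ [HW Hb]] x n.
assert (Hn : forall j, coord (W (basis j)) n
  = (RtoC (lam j) * (if Nat.eqb n (S j) then 1 else 0))%C)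
  by (intros j; now rewrite Hb).
destruct n as [|n]; simpl shift_seq.
- rewrite <- (Cmult_0_l (coord x 0)).
  apply (is_linear_ext_basis (V := C_NormedModule)
    (fun x => coord (W x) 0) (fun x => (0 * coord x 0)%C)).
  + now apply is_linear_coord.
  + apply is_linear_coord_scal.
  + intros j; rewrite Hn; simpl; now rewrite Cmult_0_r, Cmult_0_l.
- apply (is_linear_ext_basis (V := C_NormedModule)
    (fun x => coord (W x) (S n)) (fun x => (RtoC (lam n) * coord x n)%C)).
  + now apply is_linear_coord.
  + apply is_linear_coord_scal.
  + intros j; rewrite Hn; unfold coord; simpl.
    destruct (Nat.eqb_spec n j) as [->|]; [reflexivity | now rewrite !Cmult_0_r].
Qed.

(** * The ratio of weights and diagonal operators *)

(** The square root of [hat om n / hat lam n], in the recursive form that the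
    intertwining relation produces. *)
Fixpoint weight_ratio (lam om : nat -> R) (n : nat) : R :=
  match n with
  | O => 1
  | S m => om m / lam m * weight_ratio lam om m
  end.

Lemma hat_pos (lam : nat -> R) (n : nat) : (forall n, 0 < lam n) -> 0 < hat lam n.
Proof.
intros H; induction n as [|n IH]; [apply Rlt_0_1|].
change (0 < hat lam n * lam n ^ 2).
apply Rmult_lt_0_compat; [exact IH | apply pow_lt, H].
Qed.

Lemma weight_ratio_pos (lam om : nat -> R) (n : nat) :
  (forall n, 0 < lam n) -> (forall n, 0 < om n) -> 0 < weight_ratio lam om n.
Proof.
intros Hl Ho; induction n as [|n IH]; simpl; [lra|].
apply Rmult_lt_0_compat; [now apply Rdiv_lt_0_compat | exact IH].
Qed.

Lemma weight_ratio_sq (lam om : nat -> R) (n : nat) : (forall n, 0 < lam n) ->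
  weight_ratio lam om n ^ 2 = hat om n / hat lam n.
Proof.
intros Hl; induction n as [|n IH]; [simpl; field|].
change ((om n / lam n * weight_ratio lam om n) ^ 2
  = hat om n * om n ^ 2 / (hat lam n * lam n ^ 2)).
rewrite Rpow_mult_distr, IH.
assert (H1 := Hl n); assert (H2 := hat_pos lam n Hl); field; lra.
Qed.

Lemma diag_sq_summable (d : nat -> R) (M : R) (x : ell2) :
  (forall n, Rabs (d n) <= M) -> sq_summable (fun n => RtoC (d n) * coord x n)%C.
Proof.
intros Hd.
apply ex_series_le_pos with (fun n => M ^ 2 * Cmod (coord x n) ^ 2).
- intros n; split; [apply pow2_ge_0|].
  rewrite <- Rpow_mult_distr, Cmod_mult, Cmod_R; apply pow_incr; split.
  + apply Rmult_le_pos; [apply Rabs_pos | apply Cmod_ge_0].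
  + apply Rmult_le_compat_r; [apply Cmod_ge_0 | apply Hd].
- apply (@ex_series_scal_l R_AbsRing), (proj2_sig x).
Qed.

Definition diag (d : nat -> R) (M : R) (Hd : forall n, Rabs (d n) <= M)
    (x : ell2) : ell2 :=
  exist _ _ (diag_sq_summable d M x Hd).

Lemma is_linear_diag (d : nat -> R) (M : R) (Hd : forall n, Rabs (d n) <= M) :
  is_linear (diag d M Hd).
Proof.
split.
- intros x y; apply ell2_ext; intros n; apply Cmult_plus_distr_l.
- intros k x; apply ell2_ext; intros n.
  change (RtoC (d n) * (k * coord x n) = k * (RtoC (d n) * coord x n))%C; ring.
- assert (HM : 0 <= M) by (eapply Rle_trans; [apply Rabs_pos | apply (Hd O)]).
  exists (M + 1); split; [lra|]; intros x.
  change (ell2_norm (diag d M Hd x) <= (M + 1) * ell2_norm x).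
  apply ell2_norm_le; [lra|]; intros n.
  change (Cmod (RtoC (d n) * coord x n) <= (M + 1) * Cmod (coord x n)).
  rewrite Cmod_mult, Cmod_R.
  apply Rmult_le_compat_r; [apply Cmod_ge_0 | specialize (Hd n); lra].
Qed.

(** The range contains every finitely supported vector, although the inverse
    need not be bounded. *)
Lemma diag_quasi_invertible (d : nat -> R) (M : R) (Hd : forall n, Rabs (d n) <= M) :
  (forall n, d n <> 0) -> quasi_invertible (diag d M Hd).
Proof.
intros H0.
assert (HC : forall n, RtoC (d n) <> 0%C).
{ intros n Hn; apply (H0 n); now apply RtoC_inj. }
split.
- intros x y E; apply ell2_ext; intros n.
  assert (En : (RtoC (d n) * coord x n = RtoC (d n) * coord y n)%C)
    by exact (f_equal (fun z => coord z n) E).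
  replace (coord x n) with (/ RtoC (d n) * (RtoC (d n) * coord x n))%C
    by (field; apply HC).
  rewrite En; field; apply HC.
- intros y eps.
  destruct (truncate_dense y eps (cond_pos eps)) as [N HN].
  exists (truncate N (fun k => / RtoC (d k) * coord y k)%C).
  replace (diag d M Hd _) with (truncate N (coord y)).
  { now apply ball_sym. }
  apply ell2_ext; intros k.
  change ((if Nat.ltb k N then coord y k else 0)
    = RtoC (d k) * (if Nat.ltb k N then / RtoC (d k) * coord y k else 0))%C.
  destruct (Nat.ltb k N); [field; apply HC | ring].
Qed.

(** * Intertwiners and the growth of the weights *)

Lemma intertwiner_coord (lam om : nat -> R) (Wlam Wom X : ell2 -> ell2) :
  is_weighted_shift lam Wlam -> is_weighted_shift om Wom ->
  is_linear X -> (forall x, X (Wlam x) = Wom (X x)) ->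
  forall n k, coord (X (basis (S n))) k
    = (/ RtoC (lam n) * shift_seq om (coord (X (basis n))) k)%C.
Proof.
intros [[Hl _] [_ Hb]] Hom HX Hi n k.
rewrite <- (coord_weighted_shift om Wom Hom), <- Hi, Hb.
rewrite (linear_scal X HX).
change (coord (X (basis (S n))) k
  = / RtoC (lam n) * (RtoC (lam n) * coord (X (basis (S n))) k))%C.
field; intros E; apply RtoC_inj in E; specialize (Hl n); lra.
Qed.

(** At [k = n + 1] the recursion for the columns of [X] involves the diagonal
    entries alone. *)
Lemma intertwiner_diagonal (lam om : nat -> R) (Wlam Wom X : ell2 -> ell2) :
  is_weighted_shift lam Wlam -> is_weighted_shift om Wom ->
  is_linear X -> (forall x, X (Wlam x) = Wom (X x)) ->
  forall n, coord (X (basis n)) n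
    = (RtoC (weight_ratio lam om n) * coord (X (basis 0)) 0)%C.
Proof.
intros Hlam Hom HX Hi n; induction n as [|n IH].
- now rewrite Cmult_1_l.
- rewrite (intertwiner_coord lam om Wlam Wom X) by assumption.
  simpl shift_seq; simpl weight_ratio; rewrite IH.
  assert (Hl : lam n <> 0) by (apply Rgt_not_eq, Hlam).
  rewrite RtoC_mult, RtoC_div by exact Hl.
  field; intros E; apply Hl; now apply RtoC_inj.
Qed.

(** Otherwise the range of [X] would lie in the closed hyperplane orthogonal
    to [e_0]. *)
Lemma dense_intertwiner_corner (lam om : nat -> R) (Wlam Wom X : ell2 -> ell2) :
  is_weighted_shift lam Wlam -> is_weighted_shift om Wom ->
  is_linear X -> (forall x, X (Wlam x) = Wom (X x)) ->
  has_dense_range X -> coord (X (basis 0)) 0 <> 0%C.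
Proof.
intros Hlam Hom HX Hi Hd H0.
assert (Hz : forall x, coord (X x) 0 = 0%C).
{ intros x; rewrite <- (Cmult_0_l (coord x 0)).
  apply (is_linear_ext_basis (V := C_NormedModule)
    (fun x => coord (X x) 0) (fun x => (0 * coord x 0)%C)).
  - now apply is_linear_coord.
  - apply is_linear_coord_scal.
  - intros [|n]; rewrite Cmult_0_l; [exact H0|].
    rewrite (intertwiner_coord lam om Wlam Wom X) by assumption.
    apply Cmult_0_r. }
(* The zero coordinate of [X x - e_0] is [-1], so [X x] stays at distance at
   least 1 from [e_0]. *)
destruct (Hd (basis 0) (mkposreal 1 Rlt_0_1)) as [x Hx].
change (ell2_norm (minus (X x) (basis 0)) < 1) in Hx.
assert (Hc := Cmod_coord_le (minus (X x) (basis 0)) 0).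
change (coord (minus (X x) (basis 0)) 0) with (coord (X x) 0 - 1)%C in Hc.
rewrite Hz in Hc; unfold Cminus in Hc.
rewrite Cplus_0_l, Cmod_m1 in Hc; lra.
Qed.

Lemma dense_intertwiner_ratio_bounded (lam om : nat -> R) (Wlam Wom X : ell2 -> ell2) :
  is_weighted_shift lam Wlam -> is_weighted_shift om Wom ->
  is_linear X -> (forall x, X (Wlam x) = Wom (X x)) -> has_dense_range X ->
  exists M, forall n, hat om n / hat lam n <= M.
Proof.
intros Hlam Hom HX Hi Hd.
destruct (linear_norm X HX) as [K [HK BK]].
assert (Hc := dense_intertwiner_corner lam om Wlam Wom X Hlam Hom HX Hi Hd).
apply Cmod_gt_0 in Hc.
set (c := Cmod (coord (X (basis 0)) 0)) in Hc.
exists ((K / c) ^ 2); intros n.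
assert (Hp := weight_ratio_pos lam om n (proj1 (proj1 Hlam)) (proj1 (proj1 Hom))).
rewrite <- weight_ratio_sq by apply Hlam.
apply pow_incr; split; [lra|].
apply Rmult_le_reg_r with c; [exact Hc|].
replace (K / c * c) with (K * ell2_norm (basis n))
  by (rewrite ell2_norm_basis; field; lra).
replace (weight_ratio lam om n * c) with (Cmod (coord (X (basis n)) n)).
- eapply Rle_trans; [apply Cmod_coord_le | apply (BK (basis n))].
- rewrite (intertwiner_diagonal lam om Wlam Wom X) by assumption.
  rewrite Cmod_mult, Cmod_R, Rabs_pos_eq by lra; reflexivity.
Qed.

Lemma bounded_ratio_quasi_affine (lam om : nat -> R) (Wlam Wom : ell2 -> ell2) (M : R) :
  is_weighted_shift lam Wlam -> is_weighted_shift om Wom ->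
  (forall n, hat om n / hat lam n <= M) -> quasi_affine_transform Wlam Wom.
Proof.
intros Hlam Hom HM.
assert (Hl := proj1 (proj1 Hlam)); assert (Ho := proj1 (proj1 Hom)).
assert (Hp := fun n => weight_ratio_pos lam om n Hl Ho).
assert (Hd : forall n, Rabs (weight_ratio lam om n) <= sqrt M).
{ intros n; rewrite Rabs_pos_eq by (apply Rlt_le, Hp).
  rewrite <- (sqrt_pow2 (weight_ratio lam om n)) by (apply Rlt_le, Hp).
  rewrite weight_ratio_sq by exact Hl; apply sqrt_le_1_alt, HM. }
exists (diag _ _ Hd); split; [apply is_linear_diag | split].
- apply diag_quasi_invertible; intros n; apply Rgt_not_eq, Hp.
- intros x; apply ell2_ext; intros n.
  rewrite (coord_weighted_shift om Wom Hom).
  change (coord (diag _ _ Hd (Wlam x)) n)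
    with (RtoC (weight_ratio lam om n) * coord (Wlam x) n)%C.
  rewrite (coord_weighted_shift lam Wlam Hlam).
  destruct n as [|n]; simpl shift_seq; [apply Cmult_0_r|].
  change (coord (diag _ _ Hd x) n)
    with (RtoC (weight_ratio lam om n) * coord x n)%C.
  simpl weight_ratio; assert (Hn : lam n <> 0) by (apply Rgt_not_eq, Hl).
  rewrite RtoC_mult, RtoC_div by exact Hn.
  field; intros E; apply Hn; now apply RtoC_inj.
Qed.

(** The case [m_infty] is excluded because the sequence has a real term. *)
Lemma Sup_seq_lt_p_infty (u : nat -> R) :
  Rbar_lt (Sup_seq (fun n => Finite (u n))) p_infty <-> exists M, forall n, u n <= M.
Proof.
split.
- assert (Hub : forall n, Rbar_le (u n) (Sup_seq (fun n => Finite (u n))))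
    by (intros n; apply (Sup_seq_minor_le _ _ n), Rle_refl).
  intros H; destruct (Sup_seq (fun n => Finite (u n))) as [M| |].
  + now exists M.
  + destruct H.
  + destruct (Hub O).
- intros [M HM].
  destruct (Sup_seq (fun n => Finite (u n))) as [l| |] eqn:E; try exact I.
  assert (H : Rbar_lt M (Sup_seq (fun n => Finite (u n)))) by (rewrite E; exact I).
  apply Sup_seq_minor_lt in H; destruct H as [n Hn].
  specialize (HM n); simpl in Hn; lra.
Qed.

Theorem lemmaA1 (lam om : nat -> R) (Wlam Wom : ell2 -> ell2)
    (Hlam : is_weighted_shift lam Wlam) (Hom : is_weighted_shift om Wom) :
  ((exists X : ell2 -> ell2,
      is_linear X /\ has_dense_range X /\
      (forall x : ell2, X (Wlam x) = Wom (X x)))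
   <-> quasi_affine_transform Wlam Wom) /\
  (quasi_affine_transform Wlam Wom
   <-> Rbar_lt (Sup_seq (fun n => Finite (hat om n / hat lam n))) p_infty).
Proof.
assert (Hdense : quasi_affine_transform Wlam Wom -> exists X : ell2 -> ell2,
    is_linear X /\ has_dense_range X /\ (forall x : ell2, X (Wlam x) = Wom (X x))).
{ intros [X [HX [[_ Hd] Hi]]]; now exists X. }
assert (Hsup : (exists X : ell2 -> ell2, is_linear X /\ has_dense_range X /\
      (forall x : ell2, X (Wlam x) = Wom (X x))) ->
    Rbar_lt (Sup_seq (fun n => Finite (hat om n / hat lam n))) p_infty).
{ intros [X [HX [Hd Hi]]]; apply Sup_seq_lt_p_infty.
  now apply (dense_intertwiner_ratio_bounded lam om Wlam Wom X). }
assert (Hqa : Rbar_lt (Sup_seq (fun n => Finite (hat om n / hat lam n))) p_infty ->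
    quasi_affine_transform Wlam Wom).
{ intros H; apply Sup_seq_lt_p_infty in H; destruct H as [M HM].
  now apply (bounded_ratio_quasi_affine lam om Wlam Wom M). }
tauto.
Qed.
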